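(* Let $p$ be an (ordinary) prime number and let $u,v\in\mathbb{Z}$ be such that $\gcd(p,v)=1$ and $u=h(v-1)$ for some $h\in\mathbb{Z}$. Let $\oplus_{ux+vy}$ be the binary operation on $\mathbb{Z}$ given by $x\oplus_{ux+vy}y=ux+vy$. Then for all $k\in\mathbb{Z}$, $$k^{\oplus^{\leftarrow}_{ux+vy}p}\equiv k\pmod p ,$$ where the congruence is the ordinary congruence of integers modulo $p$.
   Context: For a binary operation $\oplus$ on $\mathbb{Z}$, $k^{\oplus^{\leftarrow}p}$ denotes $(k\oplus(k\oplus(\cdots\oplus(k\oplus k)\cdots)))$ in which $k$ occurs exactly $p$ times. *)

(* Defs.v *)
From mathcomp Require Import all_boot all_order all_algebra.

Set Implicit Arguments.
Unset Strict Implicit.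
Unset Printing Implicit Defensive.

Import GRing.Theory.
Local Open Scope ring_scope.

(* k op (k op (... op (k op k))), with exactly p occurrences of k; the last
   argument of iterop is only a default value for p = 0. *)
Definition rpow (op : int -> int -> int) (k : int) (p : nat) : int :=
  iterop p op k k.

Fact rpow1 op k : rpow op k 1 = k. Proof. by []. Qed.

Fact rpowS op k n : rpow op k n.+2 = op k (rpow op k n.+1).
Proof. by []. Qed.

Definition linop (u v : int) : int -> int -> int := fun x y => u * x + v * y.

(* Main.v *)
(* As u = h(v - 1), the sum u(1 + v + ... + v^(n-1)) telescopes to h(v^n - 1),
   so n + 1 occurrences of k evaluate to k + k(1 + h)(v^n - 1); for n = p - 1
   the last factor vanishes modulo p by Fermat's little theorem. *)
Require Import Defs.
From mathcomp Require Import all_boot all_order all_algebra.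
From mathcomp Require Import cyclic ring.

Import GRing.Theory.
Local Open Scope ring_scope.

Lemma rpow_linop (h v k : int) (n : nat) :
  rpow (linop (h * (v - 1)) v) k n.+1 = k + k * (1 + h) * (v ^+ n - 1).
Proof.
elim: n => [|n IHn]; first by rewrite rpow1 expr0 subrr mulr0 addr0.
by rewrite rpowS IHn /linop exprS; ring.
Qed.

(** Euler's theorem carried over from [nat] to a possibly negative base [v]: the residue of [v]
    modulo [n] is a natural number with the same powers modulo [n]. *)
Lemma dvdz_expz_totient (n : nat) (v : int) :
  (0 < n)%N -> coprimez n%:Z v -> (n%:Z %| v ^+ totient n - 1)%Z.
Proof.
move=> n_gt0 co_nv; rewrite -eqz_mod_dvd -modzXm.
have: (0 <= v %% n)%Z by rewrite modz_ge0 // eqz_nat -lt0n.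
have: coprimez n%:Z (v %% n)%Z by rewrite /coprimez gcdz_modr.
(* The [Negz] case contradicts nonnegativity of the residue. *)
case: (v %% n)%Z => // a + _.
rewrite coprimezE coprime_sym => /Euler_exp_totient a_exp1.
by rewrite -[Posz a]natz -natrX natz !modz_nat a_exp1.
Qed.

Theorem theorem37 (p : nat) (u v : int) (hp : prime p)
    (hpv : gcdz p%:Z v = 1)
    (hu : exists h : int, u = h * (v - 1)) :
  forall k : int, (rpow (linop u v) k p = k %[mod p%:Z])%Z.
Proof.
move=> k; case: hu => h ->; apply/eqP.
have p_gt0 := prime_gt0 hp.
(* Only the count [p] inside [rpow] becomes [p.-1.+1]; the modulus stays [p]. *)
rewrite -[in rpow _ _ _](prednK p_gt0) rpow_linop eqz_mod_dvd addrC addKr.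
rewrite dvdz_mull // -(totient_prime hp) dvdz_expz_totient //.
exact/eqP.
Qed.
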